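(* Let $\mathcal{M}$ be a proper graph class that is immersion-closed and union-closed. Then there exist non-isomorphic graphs $G$ and $H$ such that for all $K \in \mathcal{M}$ we have $\hom(K,G) = \hom(K,H)$.
   Context: Graphs are finite, simple (no loops, no parallel edges), undirected and have nonempty vertex set; graph classes are considered up to isomorphism. A graph homomorphism from $G$ to $H$ is a function $f:V(G)\to V(H)$ such that $f(x)f(y)\in E(H)$ for all $xy\in E(G)$; $\hom(G,H)$ denotes the number of homomorphisms from $G$ to $H$. A graph class $\mathcal{M}$ is proper if it does not contain all graphs. It is union-closed if the disjoint union of any two graphs in $\mathcal{M}$ is also in $\mathcal{M}$. Given three distinct vertices $u,v,w$ with edges $uv$, $vw$, to split off $uv$ and $vw$ is to delete the edges $uv$ and $vw$ and add the edge $uw$ (possibly adding a parallel edge, so intermediate graphs in a sequence of splitting operations may be multigraphs). A graph $G$ contains a graph $H$ as an immersion if $H$ can be obtained (up to isomorphism) from a subgraph of $G$ by splitting off pairs of edges and deleting isolated vertices. Equivalently, there is an injective map $\phi:V(H)\to V(G)$ and a collection of pairwise edge-disjoint paths in $G$, one for each edge of $H$, such that the path corresponding to the edge $uv\in E(H)$ has endpoints $\phi(u)$ and $\phi(v)$. A graph class $\mathcal{M}$ is immersion-closed if for every $G\in\mathcal{M}$ and every graph $H$, if $G$ contains $H$ as an immersion, then $H\in\mathcal{M}$. *)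

(* Defs.v *)
From Stdlib Require Import Relation_Operators.
From mathcomp Require Export all_boot.

Set Implicit Arguments.
Unset Strict Implicit.
Unset Printing Implicit Defensive.

Record sgraph := SGraph {
  svertex :> finType;
  edge : rel svertex;
  edge_sym : symmetric edge;
  edge_irrefl : irreflexive edge;
  sgraph_nonempty : 0 < #|svertex|
}.

Definition is_hom (G H : sgraph) (f : G -> H) : bool :=
  [forall x, forall y, edge x y ==> edge (f x) (f y)].

Definition hom (G H : sgraph) : nat :=
  #|[set f : {ffun G -> H} | is_hom f]|.

Definition isomorphic (G H : sgraph) : Prop :=
  exists2 f : G -> H, bijective f & forall x y, edge (f x) (f y) = edge x y.

Section DisjointUnion.
Variables G H : sgraph.

Definition dunion_edge (x y : G + H) : bool :=
  match x, y with
  | inl a, inl b => edge a b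
  | inr a, inr b => edge a b
  | _, _ => false
  end.

Lemma dunion_edge_sym : symmetric dunion_edge.
Proof. by move=> [a|a] [b|b] //=; rewrite edge_sym. Qed.

Lemma dunion_edge_irrefl : irreflexive dunion_edge.
Proof. by move=> [a|a] /=; rewrite edge_irrefl. Qed.

Lemma dunion_nonempty : 0 < #|{: G + H}|.
Proof. by rewrite card_sum addn_gt0 sgraph_nonempty. Qed.

Definition disjoint_union : sgraph :=
  SGraph dunion_edge_sym dunion_edge_irrefl dunion_nonempty.
End DisjointUnion.

(* Loopless multigraphs whose vertices form a subset of a fixed type [V];
   [mult x y] is the number of parallel edges between [x] and [y]. *)
Record multigraph (V : finType) := MultiGraph {
  mverts : {set V};
  mult : V -> V -> nat;
  mult_sym : forall x y, mult x y = mult y x;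
  mult_irrefl : forall x, mult x x = 0;
  mult_verts : forall x y, 0 < mult x y -> x \in mverts
}.

Definition is_subgraph (G : sgraph) (M : multigraph G) : Prop :=
  forall x y, mult M x y <= edge x y.

(* The edge count is balanced additively to avoid truncated subtraction:
   N has one edge uv and one edge vw fewer than M, and one edge uw more. *)
Definition split_off (V : finType) (M N : multigraph V) : Prop :=
  exists u v w : V,
    [/\ [&& u != v, v != w & u != w],
        0 < mult M u v, 0 < mult M v w,
        mverts N = mverts M &
        forall x y,
          mult N x y + ([set x; y] == [set u; v]) + ([set x; y] == [set v; w])
          = mult M x y + ([set x; y] == [set u; w])].

Definition delete_isolated (V : finType) (M N : multigraph V) : Prop :=
  exists v : V,
    [/\ v \in mverts M, forall y, mult M v y = 0,
        mverts N = mverts M :\ v & forall x y, mult N x y = mult M x y].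

Definition immersion_step (V : finType) (M N : multigraph V) : Prop :=
  split_off M N \/ delete_isolated M N.

Definition multigraph_iso (V : finType) (M : multigraph V) (H : sgraph) : Prop :=
  exists f : H -> V,
    [/\ injective f, f @: [set: H] = mverts M &
        forall x y, mult M (f x) (f y) = edge x y].

Definition contains_immersion (G H : sgraph) : Prop :=
  exists M N : multigraph G,
    [/\ is_subgraph M, clos_refl_trans _ (@immersion_step G) M N
      & multigraph_iso N H].

Definition iso_closed (C : sgraph -> Prop) : Prop :=
  forall G H, isomorphic G H -> C G -> C H.

Definition proper_class (C : sgraph -> Prop) : Prop := ~ (forall G, C G).

Definition union_closed (C : sgraph -> Prop) : Prop :=
  forall G H, C G -> C H -> C (disjoint_union G H).

Definition immersion_closed (C : sgraph -> Prop) : Prop :=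
  forall G H, C G -> contains_immersion G H -> C H.

(* Main.v *)
(* Fix X outside M, n = |X|, k = (n - 1)^2.  The pair is the pair of
   Cai-Fuerer-Immerman graphs over the complete graph on k + 2 colours.  The
   homomorphisms from K lying over a colouring c of K are the solutions of a
   linear system over F_2.  If it is solvable for every proper c, translating by
   a solution gives hom(K, G) = hom(K, H).  Otherwise Fredholm duality yields
   z : V(K) -> F_2 such that if the colour classes v and w have different
   z-parities in a vertex set S, then an edge of K coloured v, w leaves S.  So
   a cut with fewer than k edges has the same parity in all colours; by
   uncrossing, this passes to the classes of the relation "not separated by a
   cut with fewer than k edges".  Some class is odd, hence meets all k + 2
   colours.  A flow from one vertex s of it to n - 1 others sends n - 1 units to
   each of these; splitting the flow paths at s gives an immersion of the
   complete graph on n vertices, hence of X, so K is not in M. *)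
From Stdlib Require Import Classical Relation_Operators.
Require Import Defs.
From mathcomp Require Import all_boot all_algebra zify.
(* [hom] is shadowed by [vector.hom]. *)
Import Defs(hom).

Set Implicit Arguments.
Unset Strict Implicit.
Unset Printing Implicit Defensive.

(** * Cuts and immersions of edge lists *)

Section Immersion.
Variable V : finType.
Implicit Types (E L : seq (V * V)) (S A B : {set V}) (u v w : V).

Definition sep S (e : V * V) := (e.1 \in S) != (e.2 \in S).

Definition cut E S := count (sep S) E.

Lemma cutC E S : cut E (~: S) = cut E S.
Proof.
by apply: eq_count => e; rewrite /sep !inE; do 2 case: (_ \in S).
Qed.

Lemma cut_submod E A B :
  cut E (A :&: B) + cut E (A :|: B) <= cut E A + cut E B.
Proof.
rewrite /cut; elim: E => //= e E; rewrite /sep !inE.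
by case: (e.1 \in A); case: (e.2 \in A); case: (e.1 \in B); case: (e.2 \in B);
  rewrite /=; lia.
Qed.

Lemma cut_posimod E A B :
  cut E (A :\: B) + cut E (B :\: A) <= cut E A + cut E B.
Proof.
rewrite /cut; elim: E => //= e E; rewrite /sep !inE.
by case: (e.1 \in A); case: (e.2 \in A); case: (e.1 \in B); case: (e.2 \in B);
  rewrite /=; lia.
Qed.

Lemma sum_eq_mem S w : (\sum_(x in S) (x == w)%:Z = (w \in S)%:Z)%R.
Proof.
case: (boolP (w \in S)) => wS.
  by rewrite (bigD1 w) //= eqxx big1 ?GRing.addr0 // => x /andP[_ /negbTE->].
by rewrite big1 // => x xS; case: eqP => // xw; rewrite -xw xS in wS.
Qed.

Lemma sum_count_mem S (T : seq V) :
  (\sum_(x in S) (count_mem x T)%:Z = (count (mem S) T)%:Z)%R.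
Proof.
elim: T => [|t T IH] /=; first by rewrite big1.
under eq_bigr => x _ do rewrite PoszD [t == x]eq_sym.
by rewrite big_split /= IH sum_eq_mem.
Qed.

(** Lists stand for multigraphs: [imm_perm] and [imm_flip] make order and orientation immaterial.
    Vertices are kept throughout; isolated ones are deleted at the very end. *)
Inductive imm : seq (V * V) -> seq (V * V) -> Prop :=
| imm_perm L L' of perm_eq L L' : imm L L'
| imm_flip u v L : imm ((u, v) :: L) ((v, u) :: L)
| imm_del e L : imm (e :: L) L
| imm_split u v w L of u != v & v != w & u != w :
    imm ((u, v) :: (v, w) :: L) ((u, w) :: L)
| imm_trans L1 L2 L3 of imm L1 L2 & imm L2 L3 : imm L1 L3.

Lemma imm_refl L : imm L L.
Proof. exact/imm_perm/perm_refl. Qed.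

Lemma imm_catr P L L' : imm L L' -> imm (L ++ P) (L' ++ P).
Proof.
elim=> {L L'} [L L' eqL|u v L|e L|u v w L uv vw uw|L1 L2 L3 _ H1 _ H2].
- by apply: imm_perm; rewrite perm_cat2r.
- exact: imm_flip.
- exact: imm_del.
- exact: imm_split.
- exact: imm_trans H1 H2.
Qed.

Lemma imm_catl P L L' : imm L L' -> imm (P ++ L) (P ++ L').
Proof.
move=> LL'; apply: (@imm_trans _ (L ++ P)).
  by apply: imm_perm; rewrite perm_catC.
apply: imm_trans (imm_catr P LL') _.
by apply: imm_perm; rewrite perm_catC.
Qed.

Lemma imm_cat L1 L2 L1' L2' :
  imm L1 L1' -> imm L2 L2' -> imm (L1 ++ L2) (L1' ++ L2').
Proof. by move=> H1 H2; apply: imm_trans (imm_catr _ H1) (imm_catl _ H2). Qed.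

Lemma imm_cons e L L' : imm L L' -> imm (e :: L) (e :: L').
Proof. exact: (@imm_catl [:: e]). Qed.

Lemma imm_nil L : imm L [::].
Proof.
elim: L => [|e L IH]; first exact: imm_refl.
exact: imm_trans (imm_del _ _) IH.
Qed.

(** * Orientations and flows *)

Definition loopless L := all (fun e => e.1 != e.2) L.
Definition outdeg L u := count (fun e => e.1 == u) L.
Definition indeg L u := count (fun e => e.2 == u) L.

Lemma perm_loopless L L' : perm_eq L L' -> loopless L -> loopless L'.
Proof. by move=> pL; rewrite /loopless (perm_all _ pL). Qed.

(* Hoffman's circulation theorem for undirected graphs.  If deleting the edge
   uv destroys the cut condition, there is a tight set X separating u from v;
   orienting uv out of X then preserves the condition, because a violating S
   crosses X along uv, which makes the submodular inequality strict. *)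
Lemma orientation_exists E (b : V -> int) :
  loopless E ->
  (\sum_x b x = 0)%R ->
  (forall S, (\sum_(x in S) b x <= (cut E S)%:Z)%R) ->
  exists L, [/\ imm E L, loopless L &
    forall u, ((outdeg L u)%:Z - (indeg L u)%:Z = b u)%R].
Proof.
elim: E b => [|[u v] E IH] b.
  move=> _ b0 bS; exists [::]; split=> // [|u]; first exact: imm_refl.
  (* Without edges, the condition on a singleton and on its complement gives [b u <= 0] and
     [- b u <= 0]. *)
  have := bS [set u]; have := bS (~: [set u]); rewrite big_set1 {bS}.
  rewrite (bigD1 u) //= in b0.
  have -> : (\sum_(x in ~: [set u]) b x = - b u)%R.
    apply/eqP; rewrite -GRing.addr_eq0 GRing.addrC -[X in _ == X]b0.
    by apply/eqP; congr (_ + _)%R; apply: eq_bigl => x; rewrite !inE.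
  by rewrite /cut /outdeg /indeg /=; lia.
rewrite {1}/loopless /= -/(loopless E) => /andP[uv ll] b0 bS.
pose f S : int := (\sum_(x in S) b x)%R.
case: (boolP [forall S, (f S <= (cut E S)%:Z)%R]) => [/forallP bE|].
  have [L [iL lL dL]] := IH b ll b0 bE.
  by exists L; split=> //; apply: imm_trans (imm_del _ _) iL.
have key (X : {set V}) u' v' : u' != v' -> u' \in X -> v' \notin X ->
    (forall S, sep S (u, v) + cut E S =
       sep S (u', v') + cut E S) ->
    imm ((u, v) :: E) ((u', v') :: E) ->
    ~~ (f X <= (cut E X)%:Z)%R ->
    exists L, [/\ imm ((u, v) :: E) L, loopless L &
      forall u, ((outdeg L u)%:Z - (indeg L u)%:Z = b u)%R].
  move=> uv' uX vX cutE immE Xbig.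
  (* The demand left for [E] once the edge is oriented from [u'] to [v']. *)
  pose b' x : int := (b x - (x == u')%:Z + (x == v')%:Z)%R.
  have b'S S : (\sum_(x in S) b' x = f S - (u' \in S)%:Z + (v' \in S)%:Z)%R.
    by rewrite /b' big_split GRing.sumrB /= !sum_eq_mem.
  have [] := IH b' ll.
  - have sumT (g : V -> int) : (\sum_(x in setT) g x = \sum_x g x)%R.
      by apply: eq_bigl => x; rewrite inE.
    by have := b'S setT; rewrite /f !sumT !inE b0 => ->.
  - move=> S; rewrite b'S.
    have := bS S; have := bS (X :&: S); have := bS (X :|: S).
    rewrite !cutE /sep !inE -/(f _) -/(f _) -/(f _) uX (negbTE vX) /=.
    have fUI : (f (X :|: S) + f (X :&: S) = f X + f S)%R.
      rewrite /f (@big_setID _ _ _ _ (X :|: S) X) (@big_setID _ _ _ _ S X) /=.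
      have -> : (X :|: S) :&: X = X.
        by apply/setP=> x; rewrite !inE; do 2 case: (x \in _).
      rewrite -GRing.addrA; congr (_ + _)%R.
      have -> : (X :|: S) :\: X = S :\: X.
        by apply/setP=> x; rewrite !inE; do 2 case: (x \in _).
      by rewrite GRing.addrC setIC.
    (* The critical [S] contains [v'] but not [u']: the edge then crosses neither [X :&: S] nor
       [X :|: S], and since [f X] exceeds [cut E X], submodularity yields the missing unit. *)
    have := cut_submod E X S; move: Xbig fUI.
    by case: (u' \in S); case: (v' \in S) => /=; lia.
  move=> L [iL lL dL]; exists ((u', v') :: L); split.
  - exact: imm_trans immE (imm_cons _ iL).
  - by rewrite /loopless /= uv'.
  - move=> x; have := dL x; rewrite /b' /outdeg /indeg /=.
    by rewrite (eq_sym u') (eq_sym v'); lia.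
rewrite negb_forall => /existsP[X Xbig]; have := bS X.
rewrite -/(f X) {1}/sep /=.
case: (boolP (u \in X)) => uX; case: (boolP (v \in X)) => vX /=; try lia.
  by move=> _; apply: (key X u v) => //; apply: imm_refl.
move=> _; apply: (key X v u) => //; last exact: imm_flip.
- by rewrite eq_sym.
- by move=> S; rewrite /sep /= eq_sym.
Qed.

(** The balance condition describes a flow of [size T] units from [s] to [T]. An edge [su] is either
    a finished spoke or, by conservation at [u], followed by an edge [uv]; splitting at [u] shortens
    the list. *)
Lemma star_of_orientation L s (T : seq V) :
  loopless L -> s \notin T ->
  (forall u, outdeg L u + count_mem u T = indeg L u + (u == s) * size T) ->
  imm L [seq (s, t) | t <- T].
Proof.
have [n] := ubnP (size L); elim: n L T => // n IH L T.
rewrite ltnS => sz ll sT bal.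
have [T0|] := posnP (size T).
  by rewrite (size0nil T0); apply: imm_nil.
move=> Tpos; have /hasP[[s' u] suL /= /eqP s's] : has (fun e => e.1 == s) L.
  rewrite has_count; have := bal s; rewrite eqxx /outdeg.
  by rewrite (count_memPn sT); lia.
subst s'; have [L1 pL] : exists L1 : seq (V * V), perm_eq L ((s, u) :: L1).
  by exists (rem (s, u) L); apply: perm_to_rem.
have su : s != u by move/allP/(_ _ suL): ll.
have ll1 := perm_loopless pL ll.
have {}bal x : (s == x) + outdeg L1 x + count_mem x T =
    (u == x) + indeg L1 x + (x == s) * size T.
  by have := bal x; rewrite /outdeg /indeg !(permP pL).
apply: imm_trans (imm_perm pL) _.
have sz1 : size L1 < n by move: sz; rewrite (perm_size pL).
case: (boolP (u \in T)) => uT.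
  have pT := perm_to_rem uT; set T1 := rem _ _ in pT.
  apply: imm_trans (imm_perm _); last by rewrite perm_sym; apply: perm_map pT.
  rewrite /=; apply/imm_cons/IH => //; first by case/andP: ll1.
    by apply: contra sT => /mem_rem.
  move=> x; have := bal x; rewrite (permP pT) (perm_size pT) /=.
  by rewrite (eq_sym s); clear; case: eqP => _ /=; lia.
have /hasP[[u' v] uvL /= /eqP u'u] : has (fun e => e.1 == u) L1.
  rewrite has_count; have := bal u; rewrite eqxx /outdeg.
  by rewrite (count_memPn uT) [u == s]eq_sym (negbTE su) /=; lia.
subst u'; have [L2 pL1] : exists L2 : seq (V * V), perm_eq L1 ((u, v) :: L2).
  by exists (rem (u, v) L1); apply: perm_to_rem.
have ll2 := perm_loopless pL1 (andP ll1).2; case/andP: ll2 => /= uv ll2.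
have {}bal x : (s == x) + outdeg L2 x + count_mem x T =
    (v == x) + indeg L2 x + (x == s) * size T.
  have := bal x; rewrite /outdeg /indeg !(permP pL1) /=; clear.
  by move: (_ == s) (size T) => c m; lia.
apply: imm_trans (imm_cons _ (imm_perm pL1)) _.
have sz2 : size L2 < size L1 by rewrite (perm_size pL1) /=.
(* Splitting here would create a loop at [s]; the two edges cancel in the balance and are
   dropped. *)
case: (eqVneq s v) => [sv|sv].
  apply: imm_trans (imm_del _ _) _; apply: imm_trans (imm_del _ _) _.
  apply: IH => //; first exact: ltn_trans sz1.
  by move=> x; have := bal x; rewrite sv; clear; lia.
apply: imm_trans (imm_split _ su uv sv) _; apply: IH => //.
- exact: leq_ltn_trans sz1.
- by rewrite /loopless /= sv.
Qed.

(* One spoke for the edge st, and for each pair t, t' one spoke to either, to be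
   split off at s. *)
Fixpoint spokes (ts : seq V) : seq V :=
  if ts is t :: ts' then
    t :: flatten [seq [:: t; t'] | t' <- ts'] ++ spokes ts'
  else [::].

Fixpoint clique s (ts : seq V) : seq (V * V) :=
  if ts is t :: ts' then
    (s, t) :: [seq (t, t') | t' <- ts'] ++ clique s ts'
  else [::].

Lemma imm_clique s ts :
  uniq (s :: ts) -> imm [seq (s, t) | t <- spokes ts] (clique s ts).
Proof.
elim: ts => [|t ts IH] /=; first by move=> _; apply: imm_refl.
rewrite inE negb_or => /and3P[/andP[st sts] tts uts].
apply: imm_cons; rewrite map_cat; apply: imm_cat; last first.
  by apply: IH; rewrite /= sts.
elim: ts sts tts {IH uts} => [|t' ts IH] /=; first by move=> *; apply: imm_refl.
rewrite !inE !negb_or => /andP[st' sts] /andP[tt' tts].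
apply: imm_trans (imm_flip _ _ _) _.
apply: imm_trans (imm_split _ _ st' tt') _; rewrite 1?eq_sym //.
by apply/imm_cons/IH.
Qed.

Lemma mem_clique s ts x y :
  x \in s :: ts -> y \in s :: ts -> x != y ->
  ((x, y) \in clique s ts) || ((y, x) \in clique s ts).
Proof.
elim: ts => [|t ts IH]; first by rewrite !inE => /eqP-> /eqP->; rewrite eqxx.
have memc a : a \in ts -> (t, a) \in [seq (t, t') | t' <- ts] by apply: map_f.
have tail z : z \in [:: s, t & ts] -> z != t -> z \in s :: ts.
  by rewrite !inE => /or3P[->//|/eqP->|->]; rewrite ?eqxx ?orbT.
have adj z : z \in s :: ts ->
    ((t, z) \in clique s (t :: ts)) || ((z, t) \in clique s (t :: ts)).
  rewrite !(inE, mem_cat) => /orP[/eqP->|/memc->]; first by rewrite eqxx !orbT.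
  by rewrite orbT.
move=> xs ys; case: (eqVneq x t) => [->|xt]; case: (eqVneq y t) => [->|yt] xy.
- by [].
- exact/adj/tail.
- by rewrite orbC; apply/adj/tail.
- have := IH (tail x xs xt) (tail y ys yt) xy.
  by rewrite /= !(inE, mem_cat) => /orP[]->; rewrite !orbT.
Qed.

(** With m terminals besides [s] there are m single spokes and two per pair: m + m(m - 1) = m^2.
    This is the source of the square in the bound on cuts. *)
Lemma size_spokes ts : size (spokes ts) = size ts ^ 2.
Proof.
elim: ts => //= t ts IH; rewrite size_cat IH.
have -> : size (flatten [seq [:: t; t'] | t' <- ts]) = 2 * size ts.
  by elim: ts {IH} => //= t' ts ->; lia.
by lia.
Qed.

Lemma mem_spokes ts : {subset spokes ts <= ts}.
Proof.
elim: ts => //= t ts IH x; rewrite !inE mem_cat; case: eqP => //= xt.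
case/orP=> [/flattenP[_ /mapP[t' t'ts ->]]|/IH //].
by rewrite !inE => /orP[]/eqP // ->.
Qed.

(** The demand [b] lets [s] send one unit per spoke. A set with a small cut contains all terminals
    or none, so its demand is 0; any other cut has at least [size T] edges, which bounds every
    demand. *)
Lemma clique_of_cuts E s ts :
  loopless E -> uniq (s :: ts) ->
  (forall S, cut E S < size ts ^ 2 ->
     {in s :: ts &, forall x y, (x \in S) = (y \in S)}) ->
  imm E (clique s ts).
Proof.
move=> ll us cutE; set T := spokes ts.
have sT : s \notin T.
  by apply: contra (andP us).1; apply: mem_spokes.
pose b x : int := ((x == s)%:Z * (size T)%:Z - (count_mem x T)%:Z)%R.
have bS S : (\sum_(x in S) b x =
    (s \in S)%:Z * (size T)%:Z - (count (mem S) T)%:Z)%R.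
  by rewrite /b GRing.sumrB -GRing.mulr_suml sum_eq_mem sum_count_mem.
have b0 : (\sum_x b x = 0)%R.
  have := bS setT; rewrite inE (eq_bigl xpredT) => [->|x]; last by rewrite inE.
  rewrite (eq_count (a2 := xpredT)) => [|x]; last by rewrite /= inE.
  by rewrite count_predT; lia.
have [|L [EL lL dL]] := orientation_exists ll b0.
  move=> S; rewrite bS.
  case: (ltnP (cut E S) (size ts ^ 2)) => [/cutE sameS|].
    case: (boolP (s \in S)) => [sS|_]; last by lia.
    have -> : count (mem S) T = size T.
      apply/eqP; rewrite -all_count; apply/allP => t /mem_spokes tts /=.
      by rewrite -(sameS s t) // !inE ?eqxx ?tts ?orbT.
    by lia.
  rewrite -size_spokes -/T; case: (s \in S); lia.
apply: imm_trans EL _; apply: imm_trans (imm_clique us).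
apply: star_of_orientation => // u.
by have := dL u; rewrite /b -/T; clear; case: (u == s) => /=; lia.
Qed.

(** * From edge lists to multigraphs *)

Definition emult L x y := count (fun e => [set x; y] == [set e.1; e.2]) L.

Lemma set2_eq x y u v :
  ([set x; y] == [set u; v]) = ((x == u) && (y == v) || (x == v) && (y == u)).
Proof.
apply/eqP/idP => [eqxy|/orP[]/andP[/eqP-> /eqP->] //]; last by rewrite setUC.
have : x \in [set u; v] by rewrite -eqxy !inE eqxx.
have : y \in [set u; v] by rewrite -eqxy !inE eqxx orbT.
have : u \in [set x; y] by rewrite eqxy !inE eqxx.
have : v \in [set x; y] by rewrite eqxy !inE eqxx orbT.
rewrite !inE (eq_sym v) (eq_sym v) (eq_sym u) (eq_sym u).
by do 4 case: (_ == _).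
Qed.

(* Deletions are absorbed by the quantifier: every subgraph N of L' arises by
   splitting alone from a subgraph M of L. *)
Lemma imm_multigraph L L' : imm L L' ->
  forall N : multigraph V, mverts N = setT ->
  (forall x y, mult N x y <= emult L' x y) ->
  exists M : multigraph V, [/\ mverts M = setT,
    forall x y, mult M x y <= emult L x y &
    clos_refl_trans _ (@immersion_step V) M N].
Proof.
elim=> {L L'} [L L' eqL|u v L|e L|u v w L uv vw uw|L1 L2 L3 _ H1 _ H2] N vN leN.
- exists N; split=> // [x y|]; last exact: rt_refl.
  by rewrite /emult (permP eqL).
- exists N; split=> // [x y|]; last exact: rt_refl.
  by have := leN x y; rewrite /emult /= [[set v; u]]setUC.
- exists N; split=> // [x y|]; last exact: rt_refl.
  by apply: leq_trans (leN x y) _; apply: leq_addl.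
- have multE x y : [set x; y] == [set u; w] -> mult N x y = mult N u w.
    by rewrite set2_eq => /orP[]/andP[/eqP-> /eqP-> //]; rewrite mult_sym.
  have emultE x y : [set x; y] == [set u; w] -> emult L x y = emult L u w.
    by move=> /eqP eqxy; rewrite /emult eqxy.
  (* If the copies of [uw] in [N] already fit into [L], no split is made. *)
  case: (leqP (mult N u w) (emult L u w)) => [small|big].
    exists N; split=> // [x y|]; last exact: rt_refl.
    have := leN x y; rewrite /emult /= -/(emult L x y).
    case: (boolP ([set x; y] == [set u; w])) => [xy|_]; last by lia.
    by rewrite multE // emultE //; lia.
  (* Otherwise [N] has an edge [uw]; undoing the split trades it for [uv] and [vw], and the
     truncated subtraction is exact. *)
  pose m x y := mult N x y + ([set x; y] == [set u; v]) +
    ([set x; y] == [set v; w]) - ([set x; y] == [set u; w]).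
  have m_sym x y : m x y = m y x by rewrite /m mult_sym [[set x; y]]setUC.
  have m_irr x : m x x = 0.
    have irr a c : a != c -> ([set x; x] == [set a; c]) = false.
      move=> ac; rewrite set2_eq [X in _ || X]andbC orbb.
      by case: eqP => //= ->; apply: negbTE.
    by rewrite /m mult_irrefl !irr.
  pose M := @MultiGraph V setT m m_sym m_irr (fun x _ _ => in_setT x).
  exists M; split=> // [x y|].
    have := leN x y; rewrite /= /m /emult /= -/(emult L x y).
    case: (boolP ([set x; y] == [set u; w])) => [xy|_]; last by lia.
    by rewrite multE // emultE //; lia.
  apply: rt_step; left; exists u, v, w; split=> //=.
  + by rewrite uv vw uw.
  + rewrite /m eqxx (set2_eq u v u w) eqxx (negbTE vw) (negbTE uw); lia.
  + rewrite /m eqxx (set2_eq v w u w) [v == u]eq_sym (negbTE uv) (negbTE vw) /=.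
    by lia.
  + move=> x y; rewrite /m subnK //.
    case: (boolP ([set x; y] == [set u; w])) => [xy|//].
    by rewrite multE //; lia.
- have [M2 [v2 le2 c2]] := H2 N vN leN.
  have [M1 [v1 le1 c1]] := H1 M2 v2 le2.
  by exists M1; split=> //; apply: rt_trans c1 c2.
Qed.

Lemma delete_isolated_verts (N : multigraph V) (B : {set V}) :
  B \subset mverts N -> (forall x y, x \notin B -> mult N x y = 0) ->
  exists N' : multigraph V, [/\ mverts N' = B, mult N' =2 mult N &
    clos_refl_trans _ (@immersion_step V) N N'].
Proof.
have [n] := ubnP #|mverts N :\: B|; elim: n N => // n IH N.
rewrite ltnS => sz BN iso.
have [/eqP D0|[v]] := set_0Vmem (mverts N :\: B).
  exists N; split=> //; last exact: rt_refl.
  by apply/eqP; rewrite eqEsubset BN -setD_eq0 D0.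
rewrite inE => /andP[vB vN].
have verts x y : 0 < mult N x y -> x \in mverts N :\ v.
  move=> xy; rewrite !inE (mult_verts xy) andbT.
  by apply: contraTneq xy => ->; rewrite iso.
pose N1 := @MultiGraph V (mverts N :\ v) _
  (@mult_sym _ N) (@mult_irrefl _ N) verts.
have [] := IH N1.
- apply: leq_trans sz; apply: proper_card; rewrite properE; apply/andP; split.
    by apply/subsetP => x; rewrite !inE => /and3P[-> _ ->].
  by apply/subsetPn; exists v; rewrite !inE ?vB ?vN // eqxx andbF.
- by rewrite subsetD1 BN.
- exact: iso.
move=> N' [vN' mN' cN']; exists N'; split=> //.
apply: rt_trans cN'; apply: rt_step; right; exists v; split=> // y.
exact: iso.
Qed.

End Immersion.

(** * Immersions in simple graphs *)

Section GraphImmersion.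
Variable G : sgraph.

(** Comparing ranks keeps one orientation of each edge, so that [cut] counts every edge once. *)
Definition edge_list : seq (G * G) :=
  [seq e <- enum {: G * G} |
    edge e.1 e.2 && (enum_rank e.1 < enum_rank e.2)].

Lemma loopless_edge_list : loopless edge_list.
Proof.
apply/allP=> e; rewrite mem_filter => /andP[/andP[e12 _] _].
by apply: contraTneq e12 => ->; rewrite edge_irrefl.
Qed.

Lemma mem_edge_list x y :
  edge x y -> ((x, y) \in edge_list) || ((y, x) \in edge_list).
Proof.
move=> xy.
have memE a b : ((a, b) \in edge_list) =
    edge a b && (enum_rank a < enum_rank b).
  by rewrite mem_filter mem_enum andbT.
rewrite !memE [edge y x]edge_sym xy /=.
rewrite -neq_ltn; apply: contraTneq xy => /val_inj/enum_rank_inj->.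
by rewrite edge_irrefl.
Qed.

Lemma emult_edge_list x y : emult edge_list x y <= edge x y.
Proof.
rewrite /emult count_filter.
wlog xy : x y / enum_rank x <= enum_rank y.
  by move=> H; case/orP: (leq_total (enum_rank x) (enum_rank y)) => /H //;
    rewrite setUC edge_sym.
apply: (@leq_trans
  (count (fun e => edge x y && (e == (x, y))) (enum {: G * G}))).
  apply: sub_count => -[a b] /=; rewrite set2_eq.
  case/andP=> /orP[]/andP[/eqP<- /eqP<-].
    by rewrite eqxx => /andP[-> _].
  by case/andP=> _; rewrite ltnNge xy.
case: (edge x y) => /=; last by rewrite count_pred0.
by rewrite (count_uniq_mem _ (enum_uniq _)) leq_b1.
Qed.

Lemma contains_clique (X : sgraph) (f : X -> G) s ts :
  injective f -> (forall a, f a \in s :: ts) ->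
  imm edge_list (clique s ts) -> contains_immersion G X.
Proof.
move=> f_inj fC immG.
pose m (x y : G) : nat :=
  [exists a, exists b, [&& f a == x, f b == y & edge a b]].
have mE a b : m (f a) (f b) = edge a b.
  congr nat_of_bool; apply/existsP/idP => [[a' /existsP[b']]|ab].
    by case/and3P=> /eqP/f_inj-> /eqP/f_inj->.
  by exists a; apply/existsP; exists b; rewrite !eqxx.
have mP x y : 0 < m x y -> exists a b, [/\ x = f a, y = f b & edge a b].
  rewrite lt0b => /existsP[a /existsP[b /and3P[/eqP<- /eqP<- ab]]].
  by exists a, b.
have m_sym x y : m x y = m y x.
  congr nat_of_bool; apply/existsP/existsP => -[a /existsP[b /and3P[fa fb ab]]];
    by exists b; apply/existsP; exists a; rewrite fa fb edge_sym.
have m_irr x : m x x = 0.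
  apply/eqP; rewrite -leqn0 leqNgt; apply/negP => /mP[a [b [-> /f_inj->]]].
  by rewrite edge_irrefl.
(* The copy of [X] placed by [f], a subgraph of the clique on [s :: ts]. Vertices outside the image
   stay until the splitting is done. *)
pose N := @MultiGraph G setT m m_sym m_irr (fun x _ _ => in_setT x).
have [|M [vM leM MN]] := imm_multigraph immG (erefl : mverts N = setT).
  move=> x y /=; case: (posnP (m x y)) => [->//|xy].
  apply: (@leq_trans 1); first exact: leq_b1.
  have [a [b [xa yb ab]]] := mP _ _ xy.
  have xy' : x != y by apply: contraTneq xy => ->; rewrite m_irr.
  rewrite /emult -has_count; apply/hasP.
  have xC : x \in s :: ts by rewrite xa.
  have yC : y \in s :: ts by rewrite yb.
  case/orP: (mem_clique xC yC xy') => mem; [exists (x, y)|exists (y, x)] => //=.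
  by rewrite setUC.
have [||N' [vN' mN' NN']] := @delete_isolated_verts G N (f @: [set: X]).
- exact: subsetT.
- move=> x y xf; apply/eqP; rewrite -leqn0 leqNgt; apply/negP.
  move=> /mP[a [b [xa _ _]]].
  by rewrite xa imset_f ?inE in xf.
exists M, N'; split.
- by move=> x y; apply: leq_trans (leM x y) (emult_edge_list x y).
- exact: rt_trans MN NN'.
- by exists f; split=> // x y; rewrite mN' /= mE.
Qed.

Lemma contains_of_cuts (X : sgraph) (C : {set G}) :
  #|X| <= #|C| ->
  (forall S, cut edge_list S < #|X|.-1 ^ 2 ->
     {in C &, forall x y, (x \in S) = (y \in S)}) ->
  contains_immersion G X.
Proof.
move=> XC cutC; have X0 := sgraph_nonempty X.
have := erefl (take #|X| (enum C)); case: {2}(take _ _) => [|s ts] Eq.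
  have := congr1 size Eq; rewrite size_takel -?cardE //= => E0.
  by rewrite E0 in X0.
have sz : size (s :: ts) = #|X| by rewrite -Eq size_takel -?cardE.
have us : uniq (s :: ts) by rewrite -Eq take_uniq ?enum_uniq.
have inC x : x \in s :: ts -> x \in C.
  by rewrite -Eq => /mem_take; rewrite mem_enum.
apply: (@contains_clique X (fun a => nth s (s :: ts) (enum_rank a)) s ts).
- move=> a b /eqP; rewrite nth_uniq ?sz //.
  by move=> /eqP/val_inj/enum_rank_inj.
- by move=> a; apply: mem_nth; rewrite sz.
- apply: clique_of_cuts us _; first exact: loopless_edge_list.
  move=> S; have -> : size ts = #|X|.-1 by rewrite -sz.
  by move=> /cutC sameS x y /inC xC /inC yC; apply: sameS.
Qed.

End GraphImmersion.

(** * Parities of small cuts *)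

Import GRing.Theory.
Local Open Scope ring_scope.

Section Parity.
Variables (K : sgraph) (F : zmodType) (k : nat).
Local Notation I := 'I_k.+2.
Variables (c : K -> I) (z : K -> F) (r : K -> K -> F).
Hypothesis r_sym : forall a b, r a b = r b a.
Hypothesis r_edge : forall a b, r a b != 0 -> edge a b.
(** In the application [z] and [r] collect the dual variables of the vertex and edge equations, and
    [zE] is the orthogonality relation at the unknown indexed by [(a, w)]. *)
Hypothesis zE : forall a w, w != c a -> z a = \sum_(b | c b == w) r a b.

Implicit Types (S A B : {set K}) (v w : I).

Definition par S v := \sum_(a in S | c a == v) z a.

Definition parity_constant S := [forall v, forall w, par S v == par S w].

Lemma parity_constantP S :
  reflect (forall v w, par S v = par S w) (parity_constant S).
Proof.
by apply: (iffP 'forall_forallP) => parS v w; apply/eqP; apply: parS.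
Qed.

(** If no edge coloured v, w leaves [S], then by [zE] both parities equal the sum of [r] over the
    pairs in [S] coloured v, w, counted from either side. *)
Lemma par_edge S v w : par S v != par S w ->
  exists a b, [/\ a \in S, b \notin S, edge a b &
    (c a == v) && (c b == w) || (c a == w) && (c b == v)].
Proof.
move=> Svw; have vw : v != w by apply: contraNneq Svw => ->.
case: (boolP [exists a, exists b, [&& a \in S, b \notin S, edge a b &
    (c a == v) && (c b == w) || (c a == w) && (c b == v)]]).
  by move=> /existsP[a /existsP[b /and4P[aS bS ab cab]]]; exists a, b.
move=> no; case/eqP: Svw.
have parE v' w' : v' != w' ->
    (v' == v) && (w' == w) || (v' == w) && (w' == v) ->
    par S v' = \sum_(a in S | c a == v') \sum_(b in S | c b == w') r a b.
  move=> vw' cvw; apply: eq_bigr => a /andP[aS /eqP ca].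
  rewrite (zE (w := w')) ?ca 1?eq_sym // [LHS](bigID [in S]) /=.
  rewrite [X in _ + X]big1 ?addr0 => [|b /andP[/eqP cb bS]].
    by apply: eq_bigl => b; rewrite andbC.
  apply/eqP; apply: contraNT no => /r_edge ab.
  apply/existsP; exists a; apply/existsP; exists b.
  by rewrite aS bS ab ca cb.
rewrite (parE v w) ?eqxx // (parE w v) ?eqxx ?orbT 1?eq_sym // exchange_big /=.
by apply: eq_bigr => b _; apply: eq_bigr => a _.
Qed.

(** If [v0] and [w0] have different parities, each of the k other colours differs in parity from one
    of them, and so provides an edge leaving [S]. *)
Lemma small_cut_parity S :
  (cut (edge_list K) S < k)%N -> parity_constant S.
Proof.
apply: contraTT; rewrite -leqNgt negb_forall => /existsP[v0].
rewrite negb_forall => /existsP[w0 Svw].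
have vw0 : v0 != w0 by apply: contraNneq Svw => ->.
(* [phi] reads off the colour of such an edge outside [v0], [w0], so distinct colours give distinct
   edges. *)
pose phi (e : K * K) := if c e.1 \in [:: v0; w0] then c e.2 else c e.1.
have -> : k = size (enum (~: [set v0; w0])).
  have := cardsC [set v0; w0]; rewrite cards2 vw0 card_ord -cardE => -[].
  by move/esym.
rewrite /cut -size_filter -(size_map phi).
apply: uniq_leq_size (enum_uniq _) _ => v.
rewrite mem_enum !inE negb_or => /andP[vv0 vw].
have {Svw vw0} : exists2 w, w \in [:: v0; w0] & par S v != par S w.
  case: (eqVneq (par S v) (par S v0)) => [<-|Sv] in Svw *.
    by exists w0; rewrite // !inE eqxx orbT.
  by exists v0; rewrite // !inE eqxx.
case=> w ww0 /par_edge[a [b [aS bS ab cab]]].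
have phiP : phi (a, b) = v /\ phi (b, a) = v.
  have vn : (v \in [:: v0; w0]) = false.
    by rewrite !inE (negbTE vv0) (negbTE vw).
  by case/orP: cab => /andP[/eqP ca /eqP cb]; rewrite /phi /= ca cb ww0 vn.
case/orP: (mem_edge_list ab) => abE; apply/mapP; [exists (a, b)|exists (b, a)];
  by rewrite ?phiP.1 ?phiP.2 // mem_filter abE /sep /= aS (negbTE bS).
Qed.

Lemma parityU A B : A :&: B = set0 ->
  parity_constant A -> parity_constant B -> parity_constant (A :|: B).
Proof.
move=> AB /parity_constantP cA /parity_constantP cB; apply/parity_constantP.
have parU v : par (A :|: B) v = par A v + par B v.
  rewrite /par (@big_setIDcond _ _ _ _ (A :|: B) A) /=; congr (_ + _).
    by apply: eq_bigl => x; rewrite !inE; case: (x \in A); rewrite ?andbF.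
  apply: eq_bigl => x; have := congr1 (fun X : {set K} => x \in X) AB.
  by rewrite !inE; case: (x \in A); case: (x \in B).
by move=> v w; rewrite !parU (cA v w) (cB v w).
Qed.

(** No edge leaves the whole vertex set, so its parities are constant by [par_edge]; those of [S]
    are subtracted. *)
Lemma parityC S : parity_constant S -> parity_constant (~: S).
Proof.
move=> /parity_constantP cS; apply/parity_constantP => v w.
have parT u : par setT u = par S u + par (~: S) u.
  rewrite /par (@big_setIDcond _ _ _ _ setT S) /=; congr (_ + _);
  by apply: eq_bigl => x; rewrite !inE ?andbT.
have : par setT v = par setT w.
  apply/eqP; apply: contraT => /par_edge[a [b [_]]].
  by rewrite inE.
by rewrite !parT (cS v w) => /addrI.
Qed.

(* Posimodularity: if two small cuts A and B meet, then A :\: B or B :\: A is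
   again small and may replace A or B, so the family can be made disjoint. *)
Lemma parity_bigcup (s : seq {set K}) :
  all (fun S => cut (edge_list K) S < k)%N s ->
  parity_constant (\bigcup_(S <- s) S).
Proof.
(* The successor makes the measure drop even when an empty set is removed. *)
have [n] := ubnP (\sum_(S <- s) #|S|.+1)%N; elim: n s => // n IH [|A s] sz.
  by move=> _; apply/parity_constantP => v w;
    rewrite big_nil /par !big_pred0 // => x; rewrite inE.
rewrite /= => /andP[smA sms]; move: sz; rewrite !big_cons ltnS => sz.
have [AB|[x]] := set_0Vmem (A :&: \bigcup_(S <- s) S).
  apply: parityU => //; first exact: small_cut_parity.
  by apply: IH sms; lia.
rewrite inE => /andP[xA]; rewrite bigcup_seq => /bigcupP[B Bs xB].
have pB := perm_to_rem Bs.
have {sms} : all (fun S => cut (edge_list K) S < k)%N (B :: rem B s).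
  by rewrite -(perm_all _ pB).
move=> /= /andP[smB sms].
move: sz; rewrite -bigcup_seq !(perm_big _ pB) /= !big_cons setUA => sz.
have := cut_posimod (edge_list K) A B.
have ltD (X Y : {set K}) : x \in X -> x \in Y -> (#|X :\: Y| < #|X|)%N.
  move=> xX xY; apply/proper_card/properP; split; first exact: subsetDl.
  by exists x; rewrite // !inE xX xY.
have ltA := ltD _ _ xA xB; have ltB := ltD _ _ xB xA.
case: (ltnP (cut (edge_list K) (A :\: B)) k) => [smD _|bigD posi].
  have -> : A :|: B = (A :\: B) :|: B.
    by apply/setP=> y; rewrite !inE; case: (y \in B); rewrite ?orbT.
  have := IH [:: A :\: B, B & rem B s]; rewrite !big_cons setUA; apply.
    by lia.
  by rewrite /= smD smB.
have -> : A :|: B = A :|: (B :\: A).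
  by apply/setP=> y; rewrite !inE; case: (y \in A); rewrite ?orbT.
have := IH [:: A, B :\: A & rem B s]; rewrite !big_cons setUA; apply.
  by lia.
by rewrite /= smA sms andbT /=; lia.
Qed.

Definition linked : rel K := fun x y =>
  [forall S : {set K},
    (cut (edge_list K) S < k)%N ==> ((x \in S) == (y \in S))].

Lemma linkedP x y :
  reflect (forall S, (cut (edge_list K) S < k)%N -> (x \in S) = (y \in S))
    (linked x y).
Proof.
by apply: (iffP 'forall_implyP) => H S /H => [/eqP|->].
Qed.

Lemma linked_equiv : equivalence_rel linked.
Proof.
move=> x y t; split=> [|/linkedP xy]; first by apply/linkedP.
by apply/linkedP/linkedP => H S sm; rewrite -(H S sm) (xy S sm).
Qed.

(** As small cuts are closed under complement, the complement of the class of [x] is the union of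
    the sets with a small cut that miss [x]. *)
Lemma parity_linked x : parity_constant [set y in setT | linked x y].
Proof.
rewrite -[X in parity_constant X]setCK; apply: parityC.
pose s := [seq S : {set K} <- enum {: {set K}} |
  (cut (edge_list K) S < k)%N && (x \notin S)].
have sE S : (S \in s) = (cut (edge_list K) S < k)%N && (x \notin S).
  by rewrite mem_filter mem_enum andbT.
have -> : ~: [set y in setT | linked x y] = \bigcup_(S <- s) S.
  apply/setP=> y; rewrite !inE bigcup_seq; apply/idP/bigcupP => [|[S]].
    rewrite negb_forall => /existsP[S]; rewrite negb_imply => /andP[sm xyS].
    case: (boolP (x \in S)) xyS => xS; case: (boolP (y \in S)) => yS // _.
      by exists (~: S); rewrite ?sE ?cutC ?sm !inE ?xS.
    by exists S; rewrite ?sE ?sm ?xS.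
  rewrite sE => /andP[sm xS] yS.
  by apply/linkedP => /(_ S sm); rewrite yS (negbTE xS).
by apply: parity_bigcup; apply/allP => S; rewrite sE => /andP[].
Qed.

(** The total is the sum over the classes, so some class has nonzero parity at [ord0], hence at
    every colour, and therefore contains all k + 2 colours. *)
Lemma linked_class_large :
  \sum_(a | c a == ord0) z a != 0 ->
  exists x, (k.+2 <= #|[set y in setT | linked x y]|)%N.
Proof.
pose P := equivalence_partition linked [set: K].
have partP : partition P [set: K].
  by apply: equivalence_partitionP => x y t _ _ _; apply: linked_equiv.
move=> z0; case: (boolP [exists x, par [set y in setT | linked x y] ord0 != 0]).
  move=> /existsP[x parx]; exists x.
  rewrite -[k.+2]card_ord; apply: leq_trans (leq_imset_card c _).
  apply: subset_leq_card.
  apply/subsetP => v _.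
  have : par [set y in setT | linked x y] v != 0.
    by rewrite ((parity_constantP _ (parity_linked x)) v ord0).
  apply: contraR => vn; rewrite /par big_pred0 // => a.
  apply: contraNF vn => /andP[ax /eqP<-]; exact: imset_f.
rewrite negb_exists => /forallP par0; case/eqP: z0.
have -> : \sum_(a | c a == ord0) z a = \sum_(a in [set: K] | c a == ord0) z a.
  by apply: eq_bigl => a; rewrite inE.
rewrite (set_partition_big_cond _ partP) big1 // => A /imsetP[x _ ->].
by apply/eqP; rewrite -[_ == _]negbK; apply: par0.
Qed.

End Parity.

(** * Cai-Fuerer-Immerman graphs *)

(** [b] lies in the row space of [A] as soon as it annihilates the columns of [cokermx], which serve
    as the test vectors [y]. *)
Lemma fredholm (F : fieldType) (I J : finType) (A : I -> J -> F) (b : J -> F) :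
  (forall y : J -> F, (forall i, \sum_j A i j * y j = 0) ->
     \sum_j b j * y j = 0) ->
  exists x : I -> F, forall j, \sum_i x i * A i j = b j.
Proof.
move=> dual.
pose Am := \matrix_(i < #|I|, j < #|J|) A (enum_val i) (enum_val j).
pose bm := \row_(j < #|J|) b (enum_val j).
have sumE (T : finType) (f : T -> F) :
    \sum_t f t = \sum_(i < #|T|) f (enum_val i).
  exact: reindex (onW_bij _ (enum_val_bij T)).
have /submxP[xm xmE] : (bm <= Am)%MS.
  rewrite submxE; apply/eqP/rowP => l; rewrite !mxE.
  rewrite -[RHS](dual (fun j => cokermx Am (enum_rank j) l)) => [|i].
    by rewrite [RHS]sumE; apply: eq_bigr => j _; rewrite mxE enum_valK.
  have /matrixP/(_ (enum_rank i) l) := mulmx_coker Am.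
  rewrite !mxE; apply: etrans.
  rewrite [LHS]sumE; apply: eq_bigr => j _; rewrite !mxE.
  by rewrite enum_rankK enum_valK.
exists (fun i => xm 0 (enum_rank i)) => j.
have /rowP/(_ (enum_rank j)) := xmE; rewrite !mxE enum_rankK => ->.
by rewrite [LHS]sumE; apply: eq_bigr => i _; rewrite mxE enum_valK enum_rankK.
Qed.

Section CFI.
Variables (F : finFieldType) (k : nat).
Hypothesis F2 : 2%N \in [pchar F].

(** Each unordered pair contributes twice, which vanishes in characteristic 2. *)
Lemma sum_symmetric (T : finType) (a : T -> T -> F) :
  (forall x y, a x y = a y x) -> \sum_x \sum_(y | y != x) a x y = 0.
Proof.
move=> a_sym; pose lt (x y : T) := (enum_rank x < enum_rank y)%N.
under eq_bigr => x _ do rewrite (bigID (lt x)).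
rewrite big_split /= -[RHS](addrr_pchar2 F2 (\sum_x \sum_(y | lt x y) a x y)).
congr (_ + _).
  apply: eq_bigr => x _; apply: eq_bigl => y; rewrite andb_idl // /lt => xy.
  by apply: contraTneq xy => ->; rewrite ltnn.
rewrite [RHS](exchange_big_dep xpredT) //=.
apply: eq_bigr => x _.
rewrite (eq_bigr (fun y => a y x)) => [|y _]; last exact: a_sym.
apply: eq_bigl => y; rewrite /lt -leqNgt [RHS]ltn_neqAle; congr (_ && _).
by rewrite (inj_eq (@ord_inj _)) (inj_eq enum_rank_inj).
Qed.

Local Notation I := 'I_k.+2.

Definition charge (u : F) (v : I) := if v == ord0 then u else 0.

(* The Cai-Fuerer-Immerman graph over the complete graph on I, twisted at ord0:
   (v, s) assigns the bit s w to each edge vw.  The unused bit s v is left free,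
   so vertices come in classes of twins. *)
Definition cfi_vertex u :=
  {p : I * {ffun I -> F} | \sum_(w | w != p.1) p.2 w == charge u p.1}.

Definition cfi_edge u : rel (cfi_vertex u) := fun p q =>
  ((val p).1 != (val q).1) && ((val p).2 (val q).1 == (val q).2 (val p).1).

Lemma cfi_edge_sym u : symmetric (@cfi_edge u).
Proof. by move=> p q; rewrite /cfi_edge eq_sym [X in _ && X]eq_sym. Qed.

Lemma cfi_edge_irrefl u : irreflexive (@cfi_edge u).
Proof. by move=> p; rewrite /cfi_edge eqxx. Qed.

Lemma cfi_zero_proof u (v : I) : charge u v = 0 ->
  \sum_(w | w != v) [ffun=> 0 : F] w == charge u v.
Proof. by move=> ->; rewrite big1 // => w _; rewrite ffunE. Qed.

Definition cfi_zero u v (uv : charge u v = 0) : cfi_vertex u :=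
  exist _ (v, [ffun=> 0]) (cfi_zero_proof uv).

Lemma cfi_nonempty u : (0 < #|{: cfi_vertex u}|)%N.
Proof. by apply/card_gt0P; exists (@cfi_zero u ord_max erefl). Qed.

Definition cfi u : sgraph :=
  SGraph (@cfi_edge_sym u) (@cfi_edge_irrefl u) (cfi_nonempty u).

(* cfi 0 has a clique meeting all fibres.  Summing the fibre constraints over
   such a clique counts every edge bit twice, so cfi 1 has none. *)
Lemma cfi_nonisomorphic : ~ isomorphic (cfi 0) (cfi 1).
Proof.
case=> f _ f_edge.
have ch0 v : charge 0 v = 0 by rewrite /charge if_same.
pose g v : I * {ffun I -> F} := val (f (cfi_zero (ch0 v))).
have gE v w : v != w -> (g v).1 != (g w).1 /\ (g v).2 (g w).1 = (g w).2 (g v).1.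
  move=> vw; have : edge (f (cfi_zero (ch0 v))) (f (cfi_zero (ch0 w))).
    by rewrite f_edge /= /cfi_edge /= vw !ffunE eqxx.
  by case/andP=> ? /eqP.
(* The images of the clique are pairwise adjacent, so their colours are distinct and exhaust [I]. *)
have g_inj : injective (fun v => (g v).1).
  by move=> v w /eqP; apply: contraTeq => /gE[].
have : \sum_v \sum_(w | w != v) (g v).2 (g w).1 = 1.
  transitivity (\sum_v charge 1 (g v).1).
    apply: eq_bigr => v _; rewrite -(eqP (valP (f (cfi_zero (ch0 v))))) -/(g v).
    rewrite [RHS](reindex_inj g_inj); apply: eq_bigl => w.
    by rewrite (inj_eq g_inj).
  have -> : \sum_v charge 1 (g v).1 = \sum_v charge 1 v.
    by rewrite [RHS](reindex_inj g_inj).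
  rewrite (bigD1 ord0) //= big1 => [|v /negbTE v0]; last by rewrite /charge v0.
  by rewrite addr0 /charge eqxx.
rewrite (eq_bigr (fun v => \sum_(w | w != v)
  (if w == v then 0 else (g v).2 (g w).1))) => [|v _]; last first.
  by apply: eq_bigr => w /negbTE->.
rewrite sum_symmetric => [/eqP|v w]; first by rewrite eq_sym oner_eq0.
by rewrite [w == v]eq_sym; case: (eqVneq v w) => // vw; apply: (gE v w vw).2.
Qed.

(** * Lifting colourings to homomorphisms *)

Section Lifts.
Variable K : sgraph.

(** For a proper [c], such an [x] is a homomorphism to [cfi 1] lying over [c]. *)
Definition cfi_solution (c : K -> I) (x : {ffun K * I -> F}) :=
  [forall a, \sum_(w | w != c a) x (a, w) == charge 1 (c a)] &&
  [forall a, forall b, edge a b ==> (x (a, c b) == x (b, c a))].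

Definition proper_coloring (c : K -> I) := forall a b, edge a b -> c a != c b.

(** Adding a solution raises the charge at [ord0] by 1. The solution depends only on the colouring,
    which the translation preserves, so the map is injective. *)
Lemma hom_cfi_le (u : F) :
  (forall c, proper_coloring c -> exists x, cfi_solution c x) ->
  (hom K (cfi u) <= hom K (cfi (u + 1)%R))%N.
Proof.
move=> sol.
pose col (h : {ffun K -> cfi u}) : {ffun K -> I} := [ffun a => (val (h a)).1].
(* Colourings induced by homomorphisms are proper, so the default is never reached on them. *)
pose X (c : {ffun K -> I}) : {ffun K * I -> F} :=
  odflt [ffun=> 0] [pick x | cfi_solution c x].
have XP (h : {ffun K -> cfi u}) : is_hom h -> cfi_solution (col h) (X (col h)).
  move=> /'forall_forallP hom_h; rewrite /X; case: pickP => // no.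
  have [a b ab|x] := sol (col h); last by rewrite no.
  by have := hom_h a b; rewrite ab !ffunE => /andP[].
pose shift (h : {ffun K -> cfi u}) : {ffun K -> cfi (u + 1)} := [ffun a =>
  insubd (@cfi_zero (u + 1) ord_max erefl)
    (col h a, [ffun w => (val (h a)).2 w + X (col h) (a, w)])].
have shiftE (h : {ffun K -> cfi u}) a : is_hom h -> val (shift h a) =
    (col h a, [ffun w => (val (h a)).2 w + X (col h) (a, w)]).
  move=> hom_h; rewrite ffunE val_insubd /=.
  have /andP[/forallP/(_ a)/eqP Xa _] := XP h hom_h.
  have -> : \sum_(w | w != col h a)
      [ffun w => (val (h a)).2 w + X (col h) (a, w)] w ==
      charge (u + 1) (col h a); last by [].
  under eq_bigr => w _ do rewrite ffunE.
  rewrite big_split /= Xa; have := eqP (valP (h a)); rewrite -[(val (h a)).1]/_.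
  rewrite ffunE => ->; rewrite /charge.
  by case: ifP; rewrite ?addr0.
have shift_inj : {in [set h : {ffun K -> cfi u} | is_hom h] &, injective shift}.
  move=> h h'; rewrite !inE => hom_h hom_h' eq_h.
  have eq_a a : val (shift h a) = val (shift h' a) by rewrite eq_h.
  have eq_col : col h = col h'.
    by apply/ffunP => a; have := eq_a a; rewrite !shiftE // => /(congr1 fst).
  apply/ffunP => a; apply/val_inj/injective_projections.
    by have /ffunP/(_ a) := eq_col; rewrite !ffunE.
  apply/ffunP => w; have := eq_a a; rewrite !shiftE // => /(congr1 snd)/=.
  by move/ffunP/(_ w); rewrite !ffunE eq_col => /addIr.
rewrite /hom -(card_in_imset shift_inj); apply: subset_leq_card.
apply/subsetP => _ /imsetP[h + ->]; rewrite !inE => hom_h.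
apply/'forall_forallP => a b; apply/implyP => ab.
have := 'forall_forallP hom_h a b; rewrite ab => /andP[cab /eqP sab].
have /andP[_ /'forall_forallP/(_ a b)] := XP h hom_h; rewrite ab => /eqP Xab.
rewrite /= /cfi_edge !shiftE //=; apply/andP; split; first by rewrite !ffunE.
apply/eqP; rewrite [LHS]ffunE [RHS]ffunE Xab; congr (_ + _).
by rewrite !ffunE.
Qed.

End Lifts.
End CFI.

(** * Solvability of the linear system *)

Lemma sum_indicator (F : pzRingType) (T : finType) (P : pred T) (f : T -> F) :
  \sum_i (P i)%:R * f i = \sum_(i | P i) f i.
Proof.
by rewrite [RHS]big_mkcond; apply: eq_bigr => i _; case: (P i);
  rewrite ?mul1r ?mul0r.
Qed.

Lemma cfi_solvable (F : finFieldType) (K X : sgraph) k (c : K -> 'I_k.+2) :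
  2%N \in [pchar F] -> k = (#|X|.-1 ^ 2)%N -> ~ contains_immersion K X ->
  proper_coloring c -> exists x : {ffun K * 'I_k.+2 -> F}, cfi_solution c x.
Proof.
move=> F2 kX noX c_proper.
(* The unknowns are the bits [(a, w)]; [inl a] indexes the equation at a vertex, [inr p] the one at
   an edge, which is zero when [p] is no edge. *)
pose A (i : K * 'I_k.+2) (j : K + K * K) : F := match j with
  | inl a => ((i.1 == a) && (i.2 != c a))%:R
  | inr p => (edge p.1 p.2 && (i == (p.1, c p.2)))%:R +
             (edge p.1 p.2 && (i == (p.2, c p.1)))%:R
  end.
pose b (j : K + K * K) : F := if j is inl a then charge 1 (c a) else 0.
have [y Ay0|x xE] := @fredholm F _ _ A b; last first.
  exists [ffun i => x i]; apply/andP; split.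
    apply/forallP => a; apply/eqP; rewrite -[RHS](xE (inl a)) /=.
    under [RHS]eq_bigr => i _ do rewrite mulrC.
    rewrite sum_indicator (reindex_onto (pair a) snd) /=; last first.
      by move=> [a' w] /= /andP[/eqP-> _].
    by apply: eq_big => [w|w _]; rewrite ?ffunE // !eqxx andbT.
  apply/'forall_forallP => a a'; apply/implyP => aa'; rewrite !ffunE.
  have := xE (inr (a, a')); rewrite /= aa' /=.
  under eq_bigr => i _ do rewrite mulrC mulrDl.
  rewrite big_split /= !sum_indicator !big_pred1_eq => /eqP.
  by rewrite addr_eq0 oppr_pchar2.
(* Each edge has an equation for either orientation; adding the two dual values makes [r]
   symmetric. *)
pose r a a' := if edge a a' then y (inr (a, a')) + y (inr (a', a)) else 0.
have r_sym a a' : r a a' = r a' a by rewrite /r edge_sym addrC.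
have r_edge a a' : r a a' != 0 -> edge a a'.
  by rewrite /r; case: ifP => //; rewrite eqxx.
have zE a w : w != c a -> y (inl a) = \sum_(a' | c a' == w) r a a'.
  move=> wa; have := Ay0 (a, w); rewrite big_sumType /= sum_indicator.
  rewrite (big_pred1 a) => [|a' /=]; last first.
    by rewrite [RHS]eq_sym; case: eqP => // <-; rewrite wa.
  under [X in _ + X]eq_bigr => p _ do rewrite mulrDl.
  rewrite big_split /= !sum_indicator => /eqP.
  rewrite addr_eq0 oppr_pchar2 // => /eqP->.
  rewrite /r -big_mkcondr big_split /=; congr (_ + _).
    rewrite (reindex_onto (pair a) snd) /= => [|[a1 a2] /andP[_ /eqP[-> _]] //].
    by apply: eq_bigl => a'; rewrite xpair_eqE !eqxx andbT andbC eq_sym.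
  rewrite (reindex_onto (pair^~ a) fst) /= => [|[a1 a2] /andP[_ /eqP[-> _]] //].
  apply: eq_bigl => a'; rewrite [edge a' a]edge_sym.
  by rewrite xpair_eqE !eqxx andbT andbC eq_sym.
rewrite big_sumType /= [X in _ + X]big1 ?addr0 => [|p _]; last by rewrite mul0r.
rewrite (eq_bigr (fun a => (c a == ord0)%:R * y (inl a))) => [|a _]; last first.
  by rewrite /charge; case: eqP.
rewrite sum_indicator; apply/eqP/negPn/negP => z0; apply: noX.
have [x Clarge] := linked_class_large r_sym r_edge zE z0.
(* With n = [#|X|], the class is large enough because n <= (n - 1)^2 + 2. *)
apply: contains_of_cuts (leq_trans _ Clarge) _; first by rewrite kX; nia.
move=> S small a a'; rewrite !inE /= => /linkedP xa /linkedP xa'.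
by rewrite -xa -?xa' // kX.
Qed.

Local Close Scope ring_scope.

Theorem theorem1p3 (M : sgraph -> Prop)
    (M_iso : iso_closed M) (M_proper : proper_class M)
    (M_imm : immersion_closed M) (M_union : union_closed M) :
  exists G H : sgraph,
    ~ isomorphic G H /\ forall K : sgraph, M K -> hom K G = hom K H.
Proof.
have [X notMX] := not_all_ex_not _ _ M_proper.
pose k := #|X|.-1 ^ 2; have F2 : 2 \in [pchar 'F_2]%R by apply: pchar_Fp.
exists (@cfi 'F_2 k 0%R), (@cfi 'F_2 k 1%R); split.
  exact: cfi_nonisomorphic.
move=> K MK; have noX : ~ contains_immersion K X.
  by move=> /(M_imm _ _ MK).
have sol (c : K -> 'I_k.+2) : proper_coloring c ->
    exists x, @cfi_solution 'F_2 k K c x.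
  exact: cfi_solvable.
(* In ['F_2] adding 1 exchanges the charges 0 and 1, so the same inequality applies in both
   directions. *)
apply/eqP; rewrite eqn_leq; apply/andP; split.
  by have := hom_cfi_le 0%R sol; rewrite add0r.
by have := hom_cfi_le 1%R sol; rewrite addrr_pchar2.
Qed.
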